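(* Let $k$ be a field and let $A$ be a connected graded $k$-algebra generated in degree $1$. Assume that for every finite-dimensional subspace $W\subset A_1$ there exists a quadratic subalgebra $B_W\subset A$ such that: (a) $W\subset (B_W)_1$ and $\dim_k (B_W)_1<\infty$; (b) $B_W$ is universally Koszul; and assume moreover that the family $(B_W)_W$ can be chosen to be filtered under inclusion. Then $A$ is asymptotically universally Koszul.
   Context: A graded $k$-algebra $A=\bigoplus_{n\ge 0}A_n$ is connected if $A_0=k$. A connected graded $k$-algebra generated in degree $1$ is quadratic if $A\cong T(V)/\langle R\rangle$ as graded algebras, where $V=A_1$ (possibly infinite-dimensional) and $R\subseteq V\otimes_k V$ is a subspace. Subalgebras are graded subalgebras. Universal Koszulity: let $A$ be a quadratic algebra with $\dim_k A_1<\infty$. Let $\mathcal L(A)$ be the set of graded left ideals $I\subseteq A$ with $I=A I_1$ (generated in degree $1$). $A$ is universally Koszul if for every $I\in\mathcal L(A)$ and every $x\in A_1\setminus I_1$, the colon ideal $I:x=\{a\in A\mid ax\in I\}$ belongs to $\mathcal L(A)$. Asymptotic universal Koszulity: a connected graded $k$-algebra $A$ generated in degree $1$ is asymptotically universally Koszul if there exists a filtered system (under inclusion) of quadratic graded subalgebras $(A_i)_{i\in I}$ of $A$ such that (i) each $A_i$ is generated in degree $1$ with $\dim_k(A_i)_1<\infty$; (ii) each $A_i$ is universally Koszul; (iii) the natural map $\varinjlim_{i\in I}A_i\to A$ is an isomorphism of graded algebras; (iv) every finite-dimensional subspace of $A_1$ is contained in some $(A_i)_1$. *)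

(* Defs.v *)
From HB Require Import structures.
From mathcomp Require Import all_boot all_algebra generic_quotient.
From mathcomp Require Import finmap boolp classical_sets monalg.

Set Implicit Arguments.
Unset Strict Implicit.
Unset Printing Implicit Defensive.

Import GRing.Theory.
Local Open Scope classical_set_scope.
Local Open Scope quotient_scope.
Local Open Scope ring_scope.

Record subspace (k : fieldType) (V : lmodType k) := Subspace {
  subspace_set :> V -> Prop;
  subspace0 : subspace_set 0;
  subspaceP : forall (c : k) (u v : V),
    subspace_set u -> subspace_set v -> subspace_set (c *: u + v) }.

Definition findim (k : fieldType) (V : lmodType k) (U : set V) : Prop :=
  exists (n : nat) (e : 'I_n -> V),
    U = [set v | exists c : 'I_n -> k, v = \sum_(i < n) c i *: e i].

Section SubspaceType.
Variables (k : fieldType) (V : lmodType k) (U : subspace V).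

Lemma subspaceD u v : U u -> U v -> U (u + v).
Proof. by move=> Uu Uv; rewrite -[u]scale1r; apply: subspaceP. Qed.

Lemma subspaceZ c u : U u -> U (c *: u).
Proof. by move=> Uu; rewrite -[_ *: _]addr0; apply/subspaceP/subspace0. Qed.

Lemma subspaceN u : U u -> U (- u).
Proof. by move=> Uu; rewrite -scaleN1r; apply: subspaceZ. Qed.

Lemma subspace_sum (I : Type) (r : seq I) (P : pred I) (F : I -> V) :
  (forall i, P i -> U (F i)) -> U (\sum_(i <- r | P i) F i).
Proof. by move=> UF; apply: big_ind => //; [apply: subspace0|apply: subspaceD]. Qed.

Definition subspace_pred : {pred V} := fun v => `[< U v >].

Lemma subspace_pred_closed : submod_closed subspace_pred.
Proof.
split; first by apply/asboolP/subspace0.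
by move=> c u v /asboolP Uu /asboolP Uv; apply/asboolP/subspaceP.
Qed.

HB.instance Definition _ :=
  GRing.isSubmodClosed.Build k V subspace_pred subspace_pred_closed.

Record subspace_type := SubspaceElt {
  subspace_val :> V; _ : subspace_val \in subspace_pred }.

HB.instance Definition _ := [isSub for subspace_val].
HB.instance Definition _ := [Choice of subspace_type by <:].
HB.instance Definition _ := [SubChoice_isSubLmodule of subspace_type by <:].

End SubspaceType.

Record graded (k : fieldType) (A : algType k) (gr : nat -> subspace A) : Prop :=
  Graded {
    graded1 : gr 0%N 1;
    gradedM : forall m n a b, gr m a -> gr n b -> gr (m + n)%N (a * b);
    graded_span : forall a, exists (N : nat) (f : nat -> A),
      (forall n, gr n (f n)) /\ a = \sum_(n < N) f n;
    graded_direct : forall (N : nat) (f : nat -> A), (forall n, gr n (f n)) ->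
      \sum_(n < N) f n = 0 -> forall n, (n < N)%N -> f n = 0 }.

Record gralg (k : fieldType) := GrAlg {
  gralg_sort :> algType k;
  gr : nat -> subspace gralg_sort;
  grP : graded gr }.

Record grhom (k : fieldType) (A B : gralg k) := GrHom {
  grhom_fun :> {lrmorphism A -> B};
  grhomP : forall n a, gr A n a -> gr B n (grhom_fun a) }.

Definition griso (k : fieldType) (A B : gralg k) (f : grhom A B) : Prop :=
  exists g : grhom B A, cancel f g /\ cancel g f.

Definition connected (k : fieldType) (A : gralg k) : Prop :=
  gr A 0 = [set c%:A | c in [set: k]] :> set A.

Definition generated_in_degree1 (k : fieldType) (A : gralg k) : Prop :=
  forall S : {pred A}, subalg_closed S ->
    (forall a, gr A 1 a -> a \in S) -> forall a, a \in S.

Section HomogeneousSums.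
Variables (k : fieldType) (V : lmodType k) (Q : nat -> subspace V).

Definition homsum : set V :=
  [set v | exists (N : nat) (f : nat -> V),
    (forall n, Q n (f n)) /\ v = \sum_(n < N) f n].

Lemma homsum_widen (N M : nat) (f : nat -> V) : (N <= M)%N ->
  \sum_(n < N) f n = \sum_(n < M) (if (n < N)%N then f n else 0).
Proof. by move=> leNM; rewrite (big_ord_widen _ _ leNM) big_mkcond. Qed.

Lemma homsum_trunc N (f : nat -> V) : (forall n, Q n (f n)) ->
  forall n, Q n (if (n < N)%N then f n else 0).
Proof. by move=> Qf n; case: ifP => // _; apply: subspace0. Qed.

Lemma homsum0 : homsum 0.
Proof.
by exists 0%N, (fun=> 0); split=> [n|]; [apply: subspace0 | rewrite big_ord0].
Qed.

Lemma homsumD u v : homsum u -> homsum v -> homsum (u + v).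
Proof.
move=> [N [f [Qf ->]]] [M [g [Qg ->]]].
exists (maxn N M), (fun n => (if (n < N)%N then f n else 0) +
                            (if (n < M)%N then g n else 0)); split.
  by move=> n; apply: subspaceD; apply: homsum_trunc.
by rewrite big_split (homsum_widen f (leq_maxl N M)) (homsum_widen g (leq_maxr N M)).
Qed.

Lemma homsum_sum (I : Type) (r : seq I) (F : I -> V) :
  (forall i, homsum (F i)) -> homsum (\sum_(i <- r) F i).
Proof. by move=> hF; apply: big_ind => //; [apply: homsum0|apply: homsumD]. Qed.

Lemma homsum_in n v : Q n v -> homsum v.
Proof.
move=> Qv; exists n.+1, (fun i => if i == n then v else 0); split.
  by move=> i; case: eqP => [->|_] //; apply: subspace0.
rewrite big_ord_recr /= eqxx big1 ?add0r // => i _.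
by rewrite ltn_eqF.
Qed.

End HomogeneousSums.

Record grsubalg (k : fieldType) (A : gralg k) := GrSubalg {
  grsubalg_set :> A -> Prop;
  grsubalg1 : grsubalg_set 1;
  grsubalgP : forall (c : k) (a b : A),
    grsubalg_set a -> grsubalg_set b -> grsubalg_set (c *: a + b);
  grsubalgM : forall a b : A,
    grsubalg_set a -> grsubalg_set b -> grsubalg_set (a * b);
  grsubalg_homogeneous : forall a : A, grsubalg_set a ->
    exists (N : nat) (f : nat -> A),
      (forall n, (grsubalg_set `&` gr A n) (f n)) /\ a = \sum_(n < N) f n }.

Section SubalgebraType.
Variables (k : fieldType) (A : gralg k) (B : grsubalg A).

Definition grsubalg_pred : {pred A} := fun a => `[< B a >].

Lemma grsubalg_pred_closed : subalg_closed grsubalg_pred.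
Proof.
split; first by apply/asboolP/grsubalg1.
- by move=> c a b /asboolP Ba /asboolP Bb; apply/asboolP/grsubalgP.
- by move=> a b /asboolP Ba /asboolP Bb; apply/asboolP/grsubalgM.
Qed.

HB.instance Definition _ := GRing.isSubalgClosed.Build k A grsubalg_pred
  (GRing.subalg_closed_semi grsubalg_pred_closed).

Record grsubalg_type := GrSubalgElt {
  grsubalg_val : A; _ : grsubalg_val \in grsubalg_pred }.

HB.instance Definition _ := [isSub for grsubalg_val].
HB.instance Definition _ := [Choice of grsubalg_type by <:].
HB.instance Definition _ := [SubChoice_isSubAlgebra of grsubalg_type by <:].

Let gr_val (n : nat) : set grsubalg_type := fun b => gr A n (val b).

Fact grsubalg_gr0 n : gr_val n 0.
Proof. by rewrite /gr_val raddf0; apply: subspace0. Qed.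

Fact grsubalg_grP n (c : k) (a b : grsubalg_type) :
  gr_val n a -> gr_val n b -> gr_val n (c *: a + b).
Proof. by rewrite /gr_val linearP; apply: subspaceP. Qed.

Definition grsubalg_gr (n : nat) : subspace grsubalg_type :=
  Subspace (@grsubalg_gr0 n) (@grsubalg_grP n).

Lemma grsubalg_graded : graded grsubalg_gr.
Proof.
split.
- change (gr_val 0 1); rewrite /gr_val rmorph1; exact: graded1 (grP A).
- move=> m n a b Aa Ab; change (gr_val (m + n)%N (a * b)).
  by rewrite /gr_val rmorphM; apply: (gradedM (grP A)).
- move=> b; have /asboolP Bb := valP b.
  have [N [f [Bf bE]]] := grsubalg_homogeneous Bb.
  have Bf' n : f n \in grsubalg_pred by apply/asboolP; case: (Bf n).
  exists N, (fun n => GrSubalgElt (Bf' n)); split=> [n|].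
    by case: (Bf n).
  by apply: val_inj; rewrite raddf_sum.
- move=> N f Af sum0 n ltnN; apply: val_inj; rewrite raddf0.
  apply: (@graded_direct _ _ _ (grP A) N (fun i => val (f i))) ltnN.
    by move=> i; apply: Af.
  by rewrite -raddf_sum sum0 raddf0.
Qed.

End SubalgebraType.

Definition grsubalg_alg (k : fieldType) (A : gralg k) (B : grsubalg A) : gralg k :=
  GrAlg (grsubalg_graded B).

Record two_sided_ideal (k : fieldType) (A : algType k) (I : set A) : Prop :=
  TwoSidedIdeal {
    ideal0 : I 0;
    idealD : forall a b, I a -> I b -> I (a + b);
    idealMl : forall a b, I b -> I (a * b);
    idealMr : forall a b, I a -> I (a * b) }.

Definition ideal_gen (k : fieldType) (A : algType k) (S : set A) : set A :=
  [set a | forall I : set A, two_sided_ideal I -> S `<=` I -> I a].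

(* An algType is a nonzero ring, so quotients need proper ideals; the degrees
   of the relations are positive to ensure this. *)
Record relations (k : fieldType) (A : gralg k) := Relations {
  relations_set :> A -> Prop;
  relations_homogeneous : forall a, relations_set a ->
    exists2 n, (0 < n)%N & gr A n a }.

Section GradedQuotient.
Variables (k : fieldType) (A : gralg k) (S : relations A).

Lemma ideal_gen_ideal : two_sided_ideal (ideal_gen S).
Proof.
split.
- by move=> I idI _; apply: ideal0.
- by move=> a b Ia Ib I idI SI; apply: idealD; [|apply: Ia|apply: Ib].
- by move=> a b Ib I idI SI; apply: idealMl => //; apply: Ib.
- by move=> a b Ia I idI SI; apply: idealMr => //; apply: Ia.
Qed.

Let I0 := ideal0 ideal_gen_ideal.
Let ID := idealD ideal_gen_ideal.
Let IMl := idealMl ideal_gen_ideal.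
Let IMr := idealMr ideal_gen_ideal.

Lemma ideal_genZ c a : ideal_gen S a -> ideal_gen S (c *: a).
Proof. by move=> Ia; rewrite -mulr_algl; apply: IMl. Qed.

(* The degree 0 part of the ideal vanishes. *)
Definition ideal_gr_set (n : nat) : set A :=
  [set a | [/\ ideal_gen S a, gr A n a & n = 0%N -> a = 0]].

Fact ideal_gr0 n : ideal_gr_set n 0.
Proof. by split=> //; apply: subspace0. Qed.

Fact ideal_grP n (c : k) (a b : A) :
  ideal_gr_set n a -> ideal_gr_set n b -> ideal_gr_set n (c *: a + b).
Proof.
move=> [Ia Aa a0] [Ib Ab b0]; split.
- by apply: ID => //; apply: ideal_genZ.
- exact: subspaceP.
- by move=> n0; rewrite a0 // b0 // scaler0 addr0.
Qed.

Definition ideal_gr (n : nat) : subspace A :=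
  Subspace (@ideal_gr0 n) (@ideal_grP n).

Lemma ideal_gen_homsum a : ideal_gen S a -> homsum ideal_gr a.
Proof.
apply; last first.
  move=> s Ss; have [n n0 grs] := relations_homogeneous Ss.
  apply: (@homsum_in _ _ _ n); split=> //; first by move=> I _; apply.
  by move=> n0'; rewrite n0' in n0.
have mult m n a' b : gr A m a' -> ideal_gr n b ->
    homsum ideal_gr (a' * b) /\ homsum ideal_gr (b * a').
  move=> Aa [Ib Ab b0]; split.
    apply: (@homsum_in _ _ _ (m + n)%N); split.
    - exact: IMl.
    - exact: (gradedM (grP A)).
    - by move=> /eqP; rewrite addn_eq0 => /andP[_ /eqP /b0 ->]; rewrite mulr0.
  apply: (@homsum_in _ _ _ (n + m)%N); split.
  - exact: IMr.
  - exact: (gradedM (grP A)).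
  - by move=> /eqP; rewrite addn_eq0 => /andP[/eqP /b0 -> _]; rewrite mul0r.
split.
- exact: homsum0.
- exact: homsumD.
- move=> a' b [N [f [If ->]]].
  have [M [g [Ag ->]]] := graded_span (grP A) a'.
  rewrite mulr_sumr; apply: homsum_sum => i; rewrite mulr_suml.
  by apply: homsum_sum => j; have [] := mult _ _ _ _ (Ag j) (If i).
- move=> b a' [N [f [If ->]]].
  have [M [g [Ag ->]]] := graded_span (grP A) a'.
  rewrite mulr_sumr; apply: homsum_sum => i; rewrite mulr_suml.
  by apply: homsum_sum => j; have [] := mult _ _ _ _ (Ag i) (If j).
Qed.

Lemma ideal_gen_component (N : nat) (f : nat -> A) :
  (forall n, gr A n (f n)) -> ideal_gen S (\sum_(n < N) f n) ->
  forall n, (n < N)%N -> ideal_gr n (f n).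
Proof.
move=> Af /ideal_gen_homsum[M [g [Ig fg]]] n ltnN.
pose f' n := if (n < N)%N then f n else 0.
pose g' n := if (n < M)%N then g n else 0.
have f'g' : f' n - g' n = 0.
  apply: (@graded_direct _ _ _ (grP A) (maxn N M) (fun n => f' n - g' n)).
  - move=> i; apply: subspaceD; first exact: homsum_trunc.
    by apply: subspaceN; apply: homsum_trunc => j; case: (Ig j).
  - rewrite sumrB -(homsum_widen f (leq_maxl N M)).
    by rewrite -(homsum_widen g (leq_maxr N M)) fg subrr.
  - by rewrite leq_max ltnN.
move/subr0_eq: f'g'; rewrite /f' ltnN => ->.
exact: (@homsum_trunc _ _ ideal_gr).
Qed.

Lemma ideal_gen_proper : ~ ideal_gen S 1.
Proof.
pose f n : A := if n == 0%N then 1 else 0.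
have Af n : gr A n (f n).
  by rewrite /f; case: eqP => [->|_]; [apply: graded1 (grP A)|apply: subspace0].
move=> I1; have := @ideal_gen_component 1 f Af.
rewrite big_ord1 => /(_ I1 0%N isT) [_ _ /(_ erefl)] /eqP.
by rewrite oner_eq0.
Qed.

Definition ideal_pred : {pred A} := fun a => `[< ideal_gen S a >].

Lemma ideal_pred_closed : zmod_closed ideal_pred.
Proof.
split; first by apply/asboolP; apply: I0.
move=> a b /asboolP Ia /asboolP Ib; apply/asboolP.
by apply: ID => //; rewrite -scaleN1r; apply: ideal_genZ.
Qed.

HB.instance Definition _ :=
  GRing.isZmodClosed.Build A ideal_pred ideal_pred_closed.

Definition grquot : Type := ring_quotient.Quotient.quot ideal_pred.

HB.instance Definition _ := GRing.Zmodule.on grquot.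
HB.instance Definition _ : EqQuotient A (ring_quotient.Quotient.equiv ideal_pred) grquot
  := EqQuotient.on grquot.

Definition grquot_pi (a : A) : grquot := \pi_grquot a.

Lemma grquot_eq a b : grquot_pi a = grquot_pi b <-> ideal_gen S (a - b).
Proof.
split=> [/eqP | Iab]; last apply/eqP;
  rewrite -(ring_quotient.Quotient.idealrBE ideal_pred); first by move/asboolP.
exact/asboolP.
Qed.

Lemma grquot_piB : {morph grquot_pi : a b / a - b}.
Proof.
move=> a b.
by rewrite /grquot_pi; rewrite (ring_quotient.Quotient.pi_add ideal_pred a (- b))
  (ring_quotient.Quotient.pi_opp ideal_pred b).
Qed.

HB.instance Definition _ :=
  GRing.isZmodMorphism.Build A grquot grquot_pi grquot_piB.

Lemma grquotW (P : grquot -> Prop) : (forall a, P (grquot_pi a)) -> forall q, P q.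
Proof. by move=> Ppi q; rewrite -[q]reprK; apply: Ppi. Qed.

Definition grquot_mul (p q : grquot) : grquot := grquot_pi (repr p * repr q).
Definition grquot_scale (c : k) (q : grquot) : grquot := grquot_pi (c *: repr q).

Lemma repr_piB a : ideal_gen S (repr (grquot_pi a) - a).
Proof. by apply/grquot_eq; rewrite /grquot_pi reprK. Qed.

Lemma grquot_piM a b : grquot_mul (grquot_pi a) (grquot_pi b) = grquot_pi (a * b).
Proof.
apply/grquot_eq; set a' := repr _; set b' := repr _.
have -> : a' * b' - a * b = (a' - a) * b' + a * (b' - b).
  by rewrite mulrBl mulrBr addrA subrK.
by apply: ID; [apply: IMr|apply: IMl]; apply: repr_piB.
Qed.

Lemma grquot_piZ c a : grquot_scale c (grquot_pi a) = grquot_pi (c *: a).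
Proof. by apply/grquot_eq; rewrite -scalerBr; apply: ideal_genZ; exact: repr_piB. Qed.

Lemma grquot_mulA : associative grquot_mul.
Proof.
move=> p q r; elim/grquotW: p => a; elim/grquotW: q => b; elim/grquotW: r => c.
by rewrite !grquot_piM mulrA.
Qed.

Lemma grquot_mul1l : left_id (grquot_pi 1) grquot_mul.
Proof. by move=> q; elim/grquotW: q => a; rewrite grquot_piM mul1r. Qed.

Lemma grquot_mul1r : right_id (grquot_pi 1) grquot_mul.
Proof. by move=> q; elim/grquotW: q => a; rewrite grquot_piM mulr1. Qed.

Lemma grquot_mulDl : left_distributive grquot_mul +%R.
Proof.
move=> p q r; elim/grquotW: p => a; elim/grquotW: q => b; elim/grquotW: r => c.
by rewrite -raddfD !grquot_piM -raddfD mulrDl.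
Qed.

Lemma grquot_mulDr : right_distributive grquot_mul +%R.
Proof.
move=> p q r; elim/grquotW: p => a; elim/grquotW: q => b; elim/grquotW: r => c.
by rewrite -raddfD !grquot_piM -raddfD mulrDr.
Qed.

Lemma grquot_oner_neq0 : grquot_pi 1 != 0.
Proof.
apply/eqP; rewrite -(raddf0 grquot_pi) => /grquot_eq; rewrite subr0.
exact: ideal_gen_proper.
Qed.

HB.instance Definition _ := GRing.Zmodule_isNzRing.Build grquot
  grquot_mulA grquot_mul1l grquot_mul1r grquot_mulDl grquot_mulDr
  grquot_oner_neq0.

Lemma grquot_scaleA c d q :
  grquot_scale c (grquot_scale d q) = grquot_scale (c * d) q.
Proof. by elim/grquotW: q => a; rewrite !grquot_piZ scalerA. Qed.

Lemma grquot_scale1 : left_id 1 grquot_scale.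
Proof. by move=> q; elim/grquotW: q => a; rewrite grquot_piZ scale1r. Qed.

Lemma grquot_scaleDr : right_distributive grquot_scale +%R.
Proof.
move=> c p q; elim/grquotW: p => a; elim/grquotW: q => b.
by rewrite -raddfD !grquot_piZ -raddfD scalerDr.
Qed.

Lemma grquot_scaleDl q : {morph grquot_scale^~ q : c d / c + d}.
Proof.
by move=> c d; elim/grquotW: q => a; rewrite !grquot_piZ -raddfD scalerDl.
Qed.

HB.instance Definition _ := GRing.Zmodule_isLmodule.Build k grquot
  grquot_scaleA grquot_scale1 grquot_scaleDr grquot_scaleDl.

Lemma grquot_scaleAl (c : k) (p q : grquot) : c *: (p * q) = (c *: p) * q.
Proof.
elim/grquotW: p => a; elim/grquotW: q => b.
change (grquot_scale c (grquot_mul (grquot_pi a) (grquot_pi b)) =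
  grquot_mul (grquot_scale c (grquot_pi a)) (grquot_pi b)).
by rewrite grquot_piM !grquot_piZ grquot_piM scalerAl.
Qed.

HB.instance Definition _ := GRing.Lmodule_isLalgebra.Build k grquot grquot_scaleAl.

Lemma grquot_scaleAr (c : k) (p q : grquot) : c *: (p * q) = p * (c *: q).
Proof.
elim/grquotW: p => a; elim/grquotW: q => b.
change (grquot_scale c (grquot_mul (grquot_pi a) (grquot_pi b)) =
  grquot_mul (grquot_pi a) (grquot_scale c (grquot_pi b))).
by rewrite grquot_piM !grquot_piZ grquot_piM scalerAr.
Qed.

HB.instance Definition _ := GRing.Lalgebra_isAlgebra.Build k grquot grquot_scaleAr.

Fact grquot_gr0 n : (grquot_pi @` gr A n) 0.
Proof. by exists 0; [apply: subspace0|rewrite raddf0]. Qed.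

Fact grquot_grP n (c : k) (p q : grquot) : (grquot_pi @` gr A n) p ->
  (grquot_pi @` gr A n) q -> (grquot_pi @` gr A n) (c *: p + q).
Proof.
move=> [a Aa <-] [b Ab <-]; exists (c *: a + b); first exact: subspaceP.
by rewrite raddfD /= -grquot_piZ.
Qed.

Definition grquot_gr (n : nat) : subspace grquot :=
  Subspace (@grquot_gr0 n) (@grquot_grP n).

Lemma grquot_graded : graded grquot_gr.
Proof.
split.
- by exists 1 => //; apply: graded1 (grP A).
- move=> m n _ _ [a Aa <-] [b Ab <-]; exists (a * b).
    exact: (gradedM (grP A)).
  by rewrite -grquot_piM.
- move=> q; elim/grquotW: q => a; have [N [f [Af ->]]] := graded_span (grP A) a.
  exists N, (fun n => grquot_pi (f n)); split; last by rewrite raddf_sum.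
  by move=> n; exists (f n).
- move=> N f /= Qf sum0 n ltnN.
  have {}Qf m : exists a, gr A m a /\ grquot_pi a = f m.
    by have [a Aa <-] := Qf m; exists a.
  have [g gP] := boolp.choice Qf.
  have -> : f n = grquot_pi (g n) by case: (gP n).
  rewrite -(raddf0 grquot_pi); apply/grquot_eq; rewrite subr0.
  have [] // := @ideal_gen_component N g _ _ n ltnN.
    by move=> m; case: (gP m).
  rewrite -[X in ideal_gen S X]subr0; apply/grquot_eq.
  rewrite raddf_sum raddf0 -[RHS]sum0.
  by apply: eq_bigr => i _; case: (gP i).
Qed.

Definition grquot_alg : gralg k := GrAlg grquot_graded.

End GradedQuotient.

Lemma malg_scaleAr (k : comNzRingType) (M : monomType) (c : k)
  (g h : {malg k[M]}) : c *: (g * h) = g * (c *: h).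
Proof.
rewrite (malgMEw (fsubset_refl (msupp g)) (msuppZ_le c h)).
rewrite malgME scaler_sumr; apply: eq_bigr => m1 _.
rewrite scaler_sumr; apply: eq_bigr => m2 _.
by apply/malgP => m; rewrite mcoeffZ !(mcoeffU, mcoeffZ) mulrnAr mulrCA.
Qed.

Section FreeAlgebra.
Variables (k : fieldType) (X : choiceType).

Definition free_type : Type := {malg k[{fmonom X}]}.

HB.instance Definition _ := GRing.Lalgebra.on free_type.
HB.instance Definition _ := GRing.Lalgebra_isAlgebra.Build k free_type
  (@malg_scaleAr k {fmonom X}).

Local Notation F := free_type.

Definition free_gr_set (n : nat) : set F :=
  [set g | forall m, g@_m != 0 -> fdeg m = n].

Fact free_gr0 n : free_gr_set n 0.
Proof. by move=> m; rewrite mcoeff0 eqxx. Qed.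

Fact free_grP n (c : k) (g h : F) :
  free_gr_set n g -> free_gr_set n h -> free_gr_set n (c *: g + h).
Proof.
move=> gn hn m; rewrite mcoeffD mcoeffZ.
case: (eqVneq g@_m 0) => [->|/gn //]; rewrite mulr0 add0r; exact: hn.
Qed.

Definition free_gr (n : nat) : subspace F :=
  Subspace (@free_gr0 n) (@free_grP n).

Lemma free_grU m : free_gr (fdeg m) << m >>.
Proof. by move=> m'; rewrite mcoeffU1; case: (m =P m') => [->|_]; rewrite ?eqxx. Qed.

Lemma free_graded : graded free_gr.
Proof.
split.
- move=> m; rewrite mcoeff1.
  by case: (m =P mone) => [-> _|_]; rewrite ?fdeg1 ?eqxx.
- move=> n p g h gn hp m; rewrite mcoeff_neq0.
  move=> /msuppM_le[m1 [m2 [gm1 hm2 ->]]].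
  by rewrite fdegM (gn m1) ?mcoeff_neq0 // (hp m2) ?mcoeff_neq0.
- move=> g; rewrite (monalgE g); apply: (@homsum_sum _ _ free_gr) => m.
  apply: (@homsum_in _ _ free_gr (fdeg m)) => m'.
  by rewrite mcoeffU; case: (m =P m') => [->|_]; rewrite ?eqxx.
- move=> N f fn sum0 n ltnN; apply/malgP => m; rewrite mcoeff0.
  case: (eqVneq (fdeg m) n) => [mn|/eqP mn]; last first.
    by apply/eqP; apply: contra_notT mn; apply: fn.
  have := congr1 (mcoeff m) sum0; rewrite raddf_sum mcoeff0 => <-.
  rewrite (bigD1 (Ordinal ltnN)) //= big1 ?addr0 // => i neq.
  apply/eqP; apply: contraNT neq => /fn; rewrite mn => ni.
  by apply/eqP/val_inj.
Qed.

Definition free_alg : gralg k := GrAlg free_graded.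

End FreeAlgebra.

Section TensorAlgebra.
Variables (k : fieldType) (V : lmodType k).

Let F := free_alg k V.

Definition linear_relation : set F :=
  [set r | exists (c : k) (u v : V),
    r = << fmu (c *: u + v) >> - (c *: << fmu u >> + << fmu v >>)
      :> {malg k[{fmonom V}]}].

Lemma linear_relation_homogeneous r : linear_relation r ->
  exists2 n, (0 < n)%N & gr F n r.
Proof.
move=> [c [u [v ->]]]; exists 1%N => //.
have gen w : gr F 1 (<< fmu w >> : {malg k[{fmonom V}]}).
  by rewrite -(fdegU w); apply: free_grU.
apply: (@subspaceD _ _ (gr F 1)); first exact: gen.
by apply/(@subspaceN _ _ (gr F 1))/subspaceP; apply: gen.
Qed.

(* T(V) is constructed as the free algebra on the set V modulo the linearity of
   V -> T(V); its component of degree n is the n-th tensor power of V. *)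
Definition tensor_alg : gralg k :=
  grquot_alg (Relations linear_relation_homogeneous).

Variables (R : subspace tensor_alg) (R2 : R `<=` gr tensor_alg 2).

Lemma quadratic_homogeneous r : R r ->
  exists2 n, (0 < n)%N & gr tensor_alg n r.
Proof. by move=> /R2 Rr; exists 2%N. Qed.

(* T(V)/<R>, where R is a subspace of the tensor square of V. *)
Definition quadratic_presentation : gralg k :=
  grquot_alg (Relations quadratic_homogeneous).

End TensorAlgebra.

Definition quadratic (k : fieldType) (A : gralg k) : Prop :=
  [/\ connected A, generated_in_degree1 A &
    exists (R : subspace (tensor_alg (subspace_type (gr A 1))))
           (R2 : R `<=` gr (tensor_alg (subspace_type (gr A 1))) 2)
           (f : grhom A (quadratic_presentation R2)), griso f].

Section Koszul.
Variables (k : fieldType) (A : gralg k).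

Record graded_left_ideal (I : set A) : Prop := GradedLeftIdeal {
  left_ideal0 : I 0;
  left_idealD : forall a b, I a -> I b -> I (a + b);
  left_idealMl : forall a b, I b -> I (a * b);
  left_ideal_homogeneous : forall a, I a -> exists (N : nat) (f : nat -> A),
    (forall n, (I `&` gr A n) (f n)) /\ a = \sum_(n < N) f n }.

(* A S, the set of finite sums of products a s. *)
Definition left_span (S : set A) : set A :=
  [set x | exists (n : nat) (a s : 'I_n -> A),
    (forall i, S (s i)) /\ x = \sum_(i < n) a i * s i].

Definition degree1_left_ideals : set (set A) :=
  [set I | graded_left_ideal I /\ I = left_span (I `&` gr A 1)].

Definition colon (I : set A) (x : A) : set A := [set a | I (a * x)].

Definition universally_koszul : Prop :=
  [/\ quadratic A, findim (gr A 1) &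
    forall I, degree1_left_ideals I ->
    forall x, (gr A 1 `\` (I `&` gr A 1)) x ->
      degree1_left_ideals (colon I x)].

End Koszul.

Section Asymptotic.
Variables (k : fieldType) (A : gralg k).

Section Colimit.
Variables (I : Type) (B : I -> grsubalg A).

Definition filtered_family : Prop :=
  inhabited I /\ forall i j, exists l, B i `<=` B l /\ B j `<=` B l.

(* The transition maps are the inclusions between the members of B: a cocone
   takes the same value on x in B i and on its image y in B j. *)
Definition cocone (L : gralg k) (f : forall i, grhom (grsubalg_alg (B i)) L) : Prop :=
  forall i j (x : grsubalg_type (B i)) (y : grsubalg_type (B j)),
    B i `<=` B j -> grsubalg_val x = grsubalg_val y -> f i x = f j y.

Definition is_colimit (L : gralg k) (f : forall i, grhom (grsubalg_alg (B i)) L) : Prop :=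
  cocone f /\
  forall (C : gralg k) (g : forall i, grhom (grsubalg_alg (B i)) C), cocone g ->
    (exists u : grhom L C, forall i x, u (f i x) = g i x) /\
    (forall u v : grhom L C, (forall i x, u (f i x) = g i x) ->
      (forall i x, v (f i x) = g i x) -> u =1 v).

(* u is the map induced by the inclusions on the colimit L of the system B. *)
Definition natural_map_iso : Prop :=
  exists (L : gralg k) (f : forall i, grhom (grsubalg_alg (B i)) L)
         (u : grhom L A),
    [/\ is_colimit f,
        forall i (x : grsubalg_type (B i)), u (f i x) = grsubalg_val x &
        griso u].

End Colimit.

(* The finite-dimensional subspaces of the degree 1 component. *)
Record fdsubspace1 := FdSubspace1 {
  fdsubspace1_space :> subspace A;
  fdsubspace1_findim : findim fdsubspace1_space;
  fdsubspace1_sub : fdsubspace1_space `<=` gr A 1 }.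

Definition asymptotically_universally_koszul : Prop :=
  [/\ connected A, generated_in_degree1 A &
    exists (I : Type) (B : I -> grsubalg A),
      [/\ filtered_family B,
          forall i, [/\ quadratic (grsubalg_alg (B i)),
                        generated_in_degree1 (grsubalg_alg (B i)) &
                        findim (gr (grsubalg_alg (B i)) 1)],
          forall i, universally_koszul (grsubalg_alg (B i)),
          natural_map_iso B &
          forall W : fdsubspace1, exists i, W `<=` B i `&` gr A 1]].

End Asymptotic.

(* Main.v *)
(* Every a in A_1 spans a line contained in some B_W, so the directed union of
   the B_W is a subalgebra containing A_1, that is A.  A directed union of
   subalgebras is their colimit: a cocone is glued by evaluating it at any
   member of the system containing the given element. *)
From HB Require Import structures.
Require Import Defs.
From mathcomp Require Import all_boot all_algebra.
From mathcomp Require Import boolp classical_sets.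

Set Implicit Arguments.
Unset Strict Implicit.

Import GRing.Theory.
Local Open Scope classical_set_scope.

Section Inclusion.
Local Open Scope ring_scope.
Variables (k : fieldType) (A : gralg k) (B : grsubalg A).

(** [cocone] and [natural_map_iso] are phrased with [grsubalg_val]. It is convertible to [val], and
    takes over its ring morphism and linear structure in order to become a [grhom]. *)
HB.instance Definition _ :=
  GRing.RMorphism.copy (@grsubalg_val k A B) (val : grsubalg_type B -> A).
HB.instance Definition _ :=
  GRing.Linear.copy (@grsubalg_val k A B) (val : grsubalg_type B -> A).

(** The degree condition is proved by the identity because the grading of [grsubalg_alg B] is that
    of [A] pulled back along [val]. *)
Definition grsubalg_incl : grhom (grsubalg_alg B) A :=
  @GrHom k (grsubalg_alg B) A (@grsubalg_val k A B) (fun n a Aa => Aa).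

Definition grsubalg_elt (a : A) (Ba : B a) : grsubalg_type B :=
  GrSubalgElt (introT (asboolP (B a)) Ba).

End Inclusion.

Definition grid (k : fieldType) (A : gralg k) : grhom A A :=
  @GrHom k A A idfun (fun n a Aa => Aa).

Section DirectedUnion.
Local Open Scope ring_scope.
Variables (k : fieldType) (A : gralg k) (I : Type) (B : I -> grsubalg A).
Hypothesis filteredB : filtered_family B.
Hypothesis coverB : forall a, exists i, B i a.

(** Reduces an identity in two elements of [A] to one inside a single member, where [g i] is already
    known to be a morphism. *)
Lemma directed_pair (a b : A) : exists i (x y : grsubalg_type (B i)),
  a = grsubalg_val x /\ b = grsubalg_val y.
Proof.
have [i Bia] := coverB a; have [j Bjb] := coverB b.
have [l [il jl]] := filteredB.2 i j.
by exists l, (grsubalg_elt (il _ Bia)), (grsubalg_elt (jl _ Bjb)).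
Qed.

Section Glue.
Variables (C : gralg k) (g : forall i, grhom (grsubalg_alg (B i)) C).
Hypothesis coneg : cocone g.

(** The member containing [a] is picked by choice; [glueE] shows that the value does not depend on
    the pick. *)
Definition glue (a : A) : C :=
  g (projT1 (cid (coverB a))) (grsubalg_elt (projT2 (cid (coverB a)))).

(** The chosen member [B j] and the given [B i] both lie in some [B l], and the cocone condition
    along each inclusion identifies both values with that of [g l]. *)
Lemma glueE i (x : grsubalg_type (B i)) : glue (grsubalg_val x) = g i x.
Proof.
rewrite /glue; case: cid => j Bjx /=.
have [l [jl il]] := filteredB.2 j i.
have Blx := jl _ Bjx.
by rewrite (@coneg _ _ _ (grsubalg_elt Blx) jl) // (@coneg _ _ x (grsubalg_elt Blx) il).
Qed.

Lemma glue_linear : linear glue.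
Proof.
move=> c a b; have [i [x [y [-> ->]]]] := directed_pair a b.
have -> : c *: grsubalg_val x + grsubalg_val y = grsubalg_val (c *: x + y).
  by rewrite -[RHS]/(val (c *: x + y)) linearP.
by rewrite !glueE linearP.
Qed.

Lemma glue_monoid : monoid_morphism glue.
Proof.
split.
  (* The system is nonempty, and any member contains the unit. *)
  have [[i] _] := filteredB.
  by rewrite -[1]/(grsubalg_val (1 : grsubalg_type (B i))) glueE rmorph1.
move=> a b; have [i [x [y [-> ->]]]] := directed_pair a b.
have -> : grsubalg_val x * grsubalg_val y = grsubalg_val (x * y).
  by rewrite -[RHS]/(val (x * y)) rmorphM.
by rewrite !glueE rmorphM.
Qed.

HB.instance Definition _ := GRing.isLinear.Build k A C _ glue glue_linear.
HB.instance Definition _ := GRing.isMonoidMorphism.Build A C glue glue_monoid.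

Lemma glue_gr n a : gr A n a -> gr C n (glue a).
Proof.
move=> Aa; have [i Bia] := coverB a.
by rewrite -[a]/(grsubalg_val (grsubalg_elt Bia)) glueE; apply: grhomP.
Qed.

Definition glue_hom : grhom A C := GrHom glue_gr.

End Glue.

Lemma directed_union_colimit : is_colimit (fun i => grsubalg_incl (B i)).
Proof.
split=> [i j x y _ //|C g coneg]; split.
  by exists (glue_hom coneg) => i x; apply: glueE.
(* Uniqueness: the inclusions are jointly surjective onto [A]. *)
move=> u v ug vg a; have [i Bia] := coverB a.
by rewrite -[a]/(grsubalg_incl (B i) (grsubalg_elt Bia)) ug vg.
Qed.

Lemma directed_union_iso : natural_map_iso B.
Proof.
(* With [A] itself as the colimit, the natural map is the identity. *)
exists A, (fun i => grsubalg_incl (B i)), (grid A); split=> //.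
  exact: directed_union_colimit.
by exists (grid A).
Qed.

End DirectedUnion.

Lemma directed_union_cover (k : fieldType) (A : gralg k) (I : Type)
    (B : I -> grsubalg A) :
  generated_in_degree1 A -> filtered_family B ->
  (forall a, gr A 1 a -> exists i, B i a) -> forall a, exists i, B i a.
Proof.
move=> genA [[i0] dirB] B1 a.
pose S : {pred A} := fun a => `[< exists i, B i a >].
suff /asboolP : a \in S by [].
apply: genA => [|{}a Aa]; last exact/asboolP/B1.
(* Directedness is what closes the union under sums and products. *)
have dir2 x y : x \in S -> y \in S -> exists l, B l x /\ B l y.
  move=> /asboolP[i Bix] /asboolP[j Bjy]; have [l [il jl]] := dirB i j.
  by exists l; split; [apply: il|apply: jl].
split; first by apply/asboolP; exists i0; apply: grsubalg1.
- move=> c x y Sx Sy; have [l [Blx Bly]] := dir2 _ _ Sx Sy.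
  by apply/asboolP; exists l; apply: grsubalgP.
- move=> x y Sx Sy; have [l [Blx Bly]] := dir2 _ _ Sx Sy.
  by apply/asboolP; exists l; apply: grsubalgM.
Qed.

Section Line.
Local Open Scope ring_scope.
Variables (k : fieldType) (V : lmodType k) (v : V).

Fact line0 : [set c *: v | c in [set: k]] 0.
Proof. by exists 0 => //; rewrite scale0r. Qed.

Fact lineP (c : k) (x y : V) : [set d *: v | d in [set: k]] x ->
  [set d *: v | d in [set: k]] y -> [set d *: v | d in [set: k]] (c *: x + y).
Proof.
move=> [d _ <-] [e _ <-]; exists (c * d + e) => //.
by rewrite scalerDl scalerA.
Qed.

Definition line : subspace V := Subspace line0 lineP.

(** [findim] asks for a finite spanning family, not a basis, so [v = 0] needs no separate case. *)
Lemma line_findim : findim line.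
Proof.
exists 1%N, (fun=> v); apply/seteqP; split=> [_ [c _ <-]|_ [c ->]].
  by exists (fun=> c); rewrite big_ord1.
by exists (c ord0) => //; rewrite big_ord1.
Qed.

End Line.

Lemma line_gr (k : fieldType) (A : gralg k) n (a : A) :
  gr A n a -> line a `<=` gr A n.
Proof. by move=> Aa _ [c _ <-]; apply: subspaceZ. Qed.

Unset Implicit Arguments.
Set Strict Implicit.

Theorem proposition3p4 (k : fieldType) (A : gralg k)
  (connA : connected A) (genA : generated_in_degree1 A)
  (hB : exists B : fdsubspace1 A -> grsubalg A,
    (forall W : fdsubspace1 A,
      [/\ quadratic (grsubalg_alg (B W)),
          W `<=` B W `&` gr A 1,
          findim (gr (grsubalg_alg (B W)) 1) &
          universally_koszul (grsubalg_alg (B W))]) /\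
    filtered_family B) :
  asymptotically_universally_koszul A.
Proof.
have [B [BP filteredB]] := hB.
have B1 a : gr A 1 a -> exists W, B W a.
  move=> Aa; pose W := FdSubspace1 (line_findim a) (line_gr Aa).
  exists W; have [_ WB _ _] := BP W.
  have Wa : W a by exists 1%R => //; rewrite scale1r.
  by have [] := WB _ Wa.
(* The system is indexed by the finite-dimensional subspaces themselves, so each [W] is its own
   witness in the last condition. *)
split=> //; exists (fdsubspace1 A), B; split=> //.
- by move=> W; have [quadB _ finB _] := BP W; split=> //; case: quadB.
- by move=> W; have [] := BP W.
- exact: directed_union_iso (directed_union_cover genA filteredB B1).
- by move=> W; exists W; have [] := BP W.
Qed.
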